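(* Let $\mathbf{V}$ be a poset, $\mathbf{H}$ a subset of maximal elements of $\mathbf{V}$, and $\mathbf{Y}=\mathbf{V}-\mathbf{H}$. For $W\in\mathbf{V}$ write $\mathbf{V}_W=\{X\in\mathbf{V}\mid X<W\}$. Assume that there exists $L\in\mathbf{V}$ such that (i) $\mathbf{H}=\{W\in\mathbf{V}\mid W \text{ maximal and } L\nleq W\}$, and (ii) for any $W\in\mathbf{Y}$, the supremum $L\vee W$ exists in $\mathbf{V}$. Then there is a zigzag of homotopy equivalences $$\bigvee_{H\in\mathbf{H}}\Sigma N(\mathbf{V}_H)\xrightarrow{\ \sim\ }N(\mathbf{V})/N(\mathbf{Y})\xleftarrow{\ \sim\ }N(\mathbf{V}).$$
   Context: Posets are considered as categories, and $N$ denotes the nerve. $\Sigma$ denotes the (unreduced) suspension: for a poset $P$, $\Sigma N(P)$ is modelled by $N(\bar P)/N(P)$, where $\bar P=P\cup\{+\}$ with $+$ a new element larger than all elements of $P$ (for $P=\emptyset$ this is $S^0$). *)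

(* Defs.v *)
From HB Require Import structures.
From Stdlib Require Import Relation_Operators.
From mathcomp Require Import all_boot all_order all_algebra generic_quotient.
From mathcomp Require Import all_classical all_reals.
From mathcomp Require Import topology normedtype.

Set Implicit Arguments.
Unset Strict Implicit.
Unset Printing Implicit Defensive.

Import Order.TTheory GRing.Theory Num.Theory.
Import numFieldNormedType.Exports.

Local Open Scope classical_set_scope.
Local Open Scope ring_scope.
Local Open Scope quotient_scope.

HB.instance Definition _ (T : choiceType) (A : set T) :=
  SubChoice.copy (set_type A) {x : T | x \in A}.
HB.instance Definition _ d (V : porderType d) (A : set V) :=
  [SubChoice_isSubPOrder of set_type A by <: with d].

Definition is_maximal d (V : porderType d) (W : V) : Prop :=
  forall X : V, (W <= X)%O -> X = W.

Definition strictly_below d (V : porderType d) (W : V) : set V :=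
  [set X | (X < W)%O].

(** [with_top P] is P with a new element [None], larger than all of P. *)
Definition with_top (P : Type) : Type := option P.
HB.instance Definition _ (P : choiceType) := Choice.copy (with_top P) (option P).

Definition with_top_le d (P : porderType d) (x y : with_top P) : bool :=
  match x, y with
  | _, None => true
  | None, Some _ => false
  | Some a, Some b => (a <= b)%O
  end.

Lemma with_top_le_refl d (P : porderType d) : reflexive (@with_top_le d P).
Proof. by case=> [a|] //=. Qed.

Lemma with_top_le_anti d (P : porderType d) : antisymmetric (@with_top_le d P).
Proof. by case=> [a|] [b|] //= /le_anti ->. Qed.

Lemma with_top_le_trans d (P : porderType d) : transitive (@with_top_le d P).
Proof. by case=> [b|] [a|] [c|] //=; exact: le_trans. Qed.

HB.instance Definition _ d (P : porderType d) :=
  Order.Le_isPOrder.Build d (with_top P)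
    (@with_top_le_refl d P) (@with_top_le_anti d P) (@with_top_le_trans d P).

Definition monotoneb d (P : porderType d) n (f : 'I_n.+1 -> P) : bool :=
  [forall i : 'I_n.+1, forall j : 'I_n.+1, (i <= j)%N ==> (f i <= f j)%O].

Lemma monotonebP d (P : porderType d) n (f : 'I_n.+1 -> P) :
  reflect (forall i j : 'I_n.+1, (i <= j)%N -> (f i <= f j)%O) (monotoneb f).
Proof.
apply: (iffP forallP) => [h i j ij|h i].
  by move/forallP: (h i) => /(_ j) /implyP; apply.
by apply/forallP => j; apply/implyP; exact: h.
Qed.

Definition chain d (P : porderType d) (n : nat) :=
  {f : {ffun 'I_n.+1 -> P} | monotoneb f}.

(** Morphisms [m] -> [n] of the simplex category. *)
Definition dmap (m n : nat) := chain 'I_n.+1 m.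

Lemma dmap_id_subproof n : monotoneb [ffun i : 'I_n.+1 => i].
Proof. by apply/monotonebP => i j ij; rewrite !ffunE. Qed.

Definition dmap_id n : dmap n n :=
  exist (fun f : {ffun _ -> _} => monotoneb f) _ (dmap_id_subproof n).

Lemma chain_comp_subproof d (P : porderType d) m n (f : chain P n)
  (t : dmap m n) : monotoneb [ffun i => val f (val t i)].
Proof.
apply/monotonebP => i j ij; rewrite !ffunE.
by apply: (monotonebP _ (valP f)); exact: (monotonebP _ (valP t)).
Qed.

Definition chain_comp d (P : porderType d) m n (f : chain P n) (t : dmap m n) :
  chain P m :=
  exist (fun f : {ffun _ -> _} => monotoneb f) _ (chain_comp_subproof f t).

Lemma chain_comp_id d (P : porderType d) n (f : chain P n) :
  chain_comp f (dmap_id n) = f.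
Proof. by apply: val_inj; apply/ffunP => i; rewrite /= !ffunE. Qed.

Lemma chain_compA d (P : porderType d) k m n (f : chain P n) (b : dmap m n)
  (a : dmap k m) : chain_comp f (chain_comp b a) = chain_comp (chain_comp f b) a.
Proof. by apply: val_inj; apply/ffunP => i; rewrite /= !ffunE. Qed.

Record sset := SSet {
  sobj :> nat -> choiceType;
  sact : forall m n, dmap m n -> sobj n -> sobj m;
  sact_id : forall n (x : sobj n), sact (dmap_id n) x = x;
  sact_comp : forall k m n (b : dmap m n) (a : dmap k m) (x : sobj n),
    sact (chain_comp b a) x = sact a (sact b x)
}.

Record shom (X Y : sset) := SHom {
  sfun :> forall n, X n -> Y n;
  sfun_act : forall m n (t : dmap m n) (x : X n),
    sfun (sact t x) = sact t (sfun x)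
}.

Record subsset (X : sset) := SubSSet {
  ssub :> forall n, set (X n);
  ssub_act : forall m n (t : dmap m n) (x : X n),
    ssub x -> ssub (sact t x)
}.

Record psset := PSSet {
  psset_sset :> sset;
  sbase : forall n, psset_sset n;
  sbase_act : forall m n (t : dmap m n), sact t (sbase n) = sbase m
}.

(** The quotient X/A is the pushout of pt <- A -> X: its n-simplices are those
    of X outside A, together with one extra simplex [None], the base point.
    In particular X/A is X with a disjoint base point when A is empty. *)
Section Quotient.
Variables (X : sset) (A : subsset X).

Definition squot_obj (n : nat) : choiceType := option (set_type (~` (A n))).

Definition squot_proj n (x : X n) : squot_obj n := insub x.

Definition squot_act m n (t : dmap m n) (x : squot_obj n) : squot_obj m :=
  if x is Some u then squot_proj (sact t (val u)) else None.

Lemma squot_projN n (x : X n) : A n x -> squot_proj x = None.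
Proof.
by move=> Ax; rewrite /squot_proj insubF //; apply/negbTE; rewrite in_setC negbK inE.
Qed.

Lemma squot_act_proj m n (t : dmap m n) (x : X n) :
  squot_act t (squot_proj x) = squot_proj (sact t x).
Proof.
have [Ax|nAx] := pselect (A n x).
  by rewrite !squot_projN //; exact: ssub_act.
have hx : x \in ~` (A n) by rewrite inE.
by rewrite {1}/squot_proj (insubT (fun y => y \in ~` (A n)) hx).
Qed.

Lemma squot_act_id n (x : squot_obj n) : squot_act (dmap_id n) x = x.
Proof. by case: x => [u|] //=; rewrite sact_id /squot_proj valK. Qed.

Lemma squot_act_comp k m n (b : dmap m n) (a : dmap k m) (x : squot_obj n) :
  squot_act (chain_comp b a) x = squot_act a (squot_act b x).
Proof. by case: x => [u|] //=; rewrite sact_comp squot_act_proj. Qed.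

Definition squot_sset : sset := SSet squot_act_id squot_act_comp.

Definition squot : psset :=
  @PSSet squot_sset (fun n => None) (fun m n t => erefl).

End Quotient.

Section Coproduct.
Variables (I : choiceType) (X : I -> sset).

Definition scoprod_obj (n : nat) : choiceType := {i : I & X i n}.

Definition scoprod_act m n (t : dmap m n) (x : scoprod_obj n) : scoprod_obj m :=
  existT _ (projT1 x) (sact t (projT2 x)).

Lemma scoprod_act_id n (x : scoprod_obj n) : scoprod_act (dmap_id n) x = x.
Proof. by case: x => i x; rewrite /scoprod_act /= sact_id. Qed.

Lemma scoprod_act_comp k m n (b : dmap m n) (a : dmap k m) (x : scoprod_obj n) :
  scoprod_act (chain_comp b a) x = scoprod_act a (scoprod_act b x).
Proof. by case: x => i x; rewrite /scoprod_act /= sact_comp. Qed.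

Definition scoprod : sset := SSet scoprod_act_id scoprod_act_comp.

End Coproduct.

(** The wedge is the coproduct modulo the subcomplex of all base points; the
    wedge of the empty family is a point. *)
Section Wedge.
Variables (I : choiceType) (X : I -> psset).

Definition base_points_set n : set (scoprod X n) :=
  [set x | projT2 x = sbase (X (projT1 x)) n].

Lemma base_points_act m n (t : dmap m n) (x : scoprod X n) :
  base_points_set x -> base_points_set (sact t x).
Proof. by rewrite /base_points_set /= => ->; rewrite sbase_act. Qed.

Definition base_points : subsset (scoprod X) := SubSSet base_points_act.

Definition swedge : psset := squot base_points.

End Wedge.

Definition nerve d (P : porderType d) : sset :=
  @SSet (fun n => chain P n) (fun m n t f => chain_comp f t)
    (@chain_comp_id d P) (fun k m n b a f => chain_compA f b a).

Section NerveSub.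
Variables (d : Order.disp_t) (P : porderType d) (A : set P).

Definition nerve_sub_set n : set (nerve P n) :=
  [set f : chain P n | forall i : 'I_n.+1, A (val f i)].

Lemma nerve_sub_act m n (t : dmap m n) (f : nerve P n) :
  nerve_sub_set f -> nerve_sub_set (sact t f).
Proof. by move=> h i; rewrite /= ffunE; exact: h. Qed.

(** The nerve of the subposet A, as a subcomplex of the nerve of P. *)
Definition nerve_sub : subsset (nerve P) := SubSSet nerve_sub_act.

End NerveSub.

Definition suspension d (P : porderType d) : psset :=
  squot (nerve_sub (range (Some : P -> with_top P))).

Definition std_simplex (R : realType) n : set 'rV[R]_n.+1 :=
  [set t | (forall i, 0 <= t 0 i) /\ \sum_i t 0 i = 1].

Definition simplex_push_row (R : realType) m n (a : dmap m n)
  (t : 'rV[R]_m.+1) : 'rV[R]_n.+1 := \row_j \sum_(i | val a i == j) t 0 i.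

Lemma simplex_push_subproof (R : realType) m n (a : dmap m n)
  (t : @std_simplex R m) :
  simplex_push_row a (val t) \in @std_simplex R n.
Proof.
have := valP t; rewrite !inE => -[t0 t1]; split=> [j|].
  by rewrite mxE; apply: sumr_ge0.
under eq_bigr do rewrite mxE.
by rewrite -t1 [in RHS](partition_big (fun i => val a i) xpredT).
Qed.

Definition simplex_push (R : realType) m n (a : dmap m n)
  (t : @std_simplex R m) : @std_simplex R n :=
  SigSub (simplex_push_subproof a t).

Section Realization.
Variables (R : realType) (X : sset).

(** The disjoint union of one standard n-simplex for each n-simplex of X. *)
Definition cells : topologicalType :=
  {s : {n : nat & X n} & set_type (@std_simplex R (projT1 s))}.

Definition cell n (x : X n) (t : @std_simplex R n) : cells :=
  existT (fun s : {n : nat & X n} => set_type (@std_simplex R (projT1 s)))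
    (existT _ n x) t.

Variant glue : cells -> cells -> Prop :=
  Glue m n (a : dmap m n) (x : X n) (t : @std_simplex R m) :
    glue (cell (sact a x) t) (cell x (simplex_push a t)).

Definition glued (p q : cells) : bool :=
  `[< clos_refl_sym_trans cells glue p q >].

Lemma glued_refl : reflexive glued.
Proof. by move=> p; apply/asboolP; exact: rst_refl. Qed.

Lemma glued_sym : symmetric glued.
Proof. by move=> p q; apply: asbool_equiv_eq; split=> ?; exact: rst_sym. Qed.

Lemma glued_trans : transitive glued.
Proof.
by move=> q p r /asboolP pq /asboolP qr; apply/asboolP; exact: rst_trans pq qr.
Qed.

Canonical glued_equiv := EquivRel glued glued_refl glued_sym glued_trans.

Definition realization : topologicalType :=
  quotient_topology {eq_quot glued_equiv}.

Definition realization_pi (p : cells) : realization := \pi_{eq_quot glued_equiv} p.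
Definition realization_repr (q : realization) : cells :=
  repr (q : {eq_quot glued_equiv}).

Lemma realization_piP (p q : cells) :
  realization_pi p = realization_pi q <-> clos_refl_sym_trans cells glue p q.
Proof.
split=> [e|h]; last by apply/eqmodP/asboolP.
apply/asboolP; change (is_true (glued_equiv p q)); exact/eqmodP.
Qed.

Lemma realization_reprK (q : realization) :
  realization_pi (realization_repr q) = q.
Proof. exact: reprK. Qed.

End Realization.

Section RealizationMap.
Variables (R : realType) (X Y : sset) (f : shom X Y).

Definition cells_map (p : cells R X) : cells R Y :=
  cell (f _ (projT2 (projT1 p))) (projT2 p).

Definition realization_map (q : realization R X) : realization R Y :=
  realization_pi (cells_map (realization_repr q)).

Lemma realization_mapE (p : cells R X) :
  realization_map (realization_pi p) = realization_pi (cells_map p).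
Proof.
rewrite /realization_map; apply/realization_piP.
have /realization_piP := realization_reprK (realization_pi p).
move: (realization_repr _) => p'.
elim=> {p p'} [_ _ [m n a x t]|p|p q _|p q r _ pq _ qr].
- apply: rst_step; change (glue (cell (f m (sact a x)) t)
    (cell (f n x) (simplex_push a t))).
  by rewrite sfun_act; exact: Glue.
- exact: rst_refl.
- exact: rst_sym.
- exact: rst_trans pq qr.
Qed.

End RealizationMap.

Definition homotopic (R : realType) (S T : topologicalType) (f g : S -> T) :
  Prop :=
  exists F : S * R -> T,
    [/\ {within [set: S] `*` `[0, 1], continuous F},
        forall x, F (x, 0) = f x & forall x, F (x, 1) = g x].

Definition homotopy_equivalence (R : realType) (S T : topologicalType)
  (f : S -> T) : Prop :=
  continuous f /\
  exists g : T -> S,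
    [/\ continuous g, homotopic R (g \o f) idfun & homotopic R (f \o g) idfun].

Definition shomotopy_equivalence (R : realType) (X Y : sset) (f : shom X Y) :
  Prop :=
  homotopy_equivalence R (@realization_map R X Y f).

(* Main.v *)
Require Import Defs.
From Stdlib Require Import Relation_Operators.
From mathcomp Require Import all_boot all_order all_algebra.
From mathcomp Require Import all_classical all_reals.
From mathcomp Require Import topology normedtype function_spaces.
From mathcomp Require Import lra.

(** The non-degenerate simplices of N(V)/N(Y) are the chains ending in some
    W of H, i.e. the chains of V_W + {+} that reach +, so that N(V)/N(Y) is
    isomorphic to the wedge of suspensions.

    For the projection N(V) -> N(V)/N(Y), let m(y) be the supremum of L and y;
    then y <= m(y) >= L contracts N(Y) to L inside N(Y).  A point of |N(V)| is
    regarded as a nondecreasing step function [0, 1] -> V, its value on the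
    last interval, of length s, lying in H.  The homotopy rescales [0, 1] so as
    to shrink that interval, until it is empty if s is small; then, inside
    |N(Y)|, it replaces the values y by m(y) on a growing final segment, and
    finally by L on a growing initial one.  Its final map collapses |N(Y)| to
    the point L, hence factors through the quotient. *)

Set Implicit Arguments.
Unset Strict Implicit.
Unset Printing Implicit Defensive.

Import Order.TTheory GRing.Theory Num.Theory.
Import numFieldNormedType.Exports.

Local Open Scope classical_set_scope.
Local Open Scope ring_scope.

Lemma mkchain_subproof d' (Q : porderType d') n (f : 'I_n.+1 -> Q) :
  (forall i j : 'I_n.+1, (i <= j)%N -> (f i <= f j)%O) -> monotoneb [ffun i => f i].
Proof. by move=> h; apply/monotonebP => i j ij; rewrite !ffunE; exact: h. Qed.

Definition mkchain d' (Q : porderType d') n (f : 'I_n.+1 -> Q) hf : chain Q n :=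
  exist (fun f : {ffun _ -> _} => monotoneb f) _ (@mkchain_subproof d' Q n f hf).

(** * Maps out of a realization: continuity and well-definedness, checked on cells *)

Section RealizationTopology.
Variables (R : realType) (X : sset).

Definition rcell n (x : X n) (t : @std_simplex R n) : realization R X :=
  realization_pi (cell x t).

Lemma realization_ind (P : realization R X -> Prop) :
  (forall n (x : X n) t, P (rcell x t)) -> forall p, P p.
Proof.
move=> h p; rewrite -(realization_reprK p).
by case: realization_repr => -[n x] t; exact: h.
Qed.

Lemma rcell_glue m n (a : dmap m n) (x : X n) (t : @std_simplex R m) :
  rcell (sact a x) t = rcell x (simplex_push a t).
Proof. by apply/realization_piP; apply: rst_step; exact: Glue. Qed.

(** The realization has the quotient topology of a disjoint union of simplices, so continuity is
    tested on each simplex separately. *)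
Lemma realization_continuous (T : topologicalType) (f : realization R X -> T) :
  (forall n (x : X n), continuous (fun t => f (rcell x t))) -> continuous f.
Proof.
move=> h; apply/quotient_continuous.
pose g (s : {n : nat & X n}) (t : @std_simplex R (projT1 s)) :=
  f (rcell (projT2 s) t).
have cg : continuous (unstable.sigT_fun g).
  by apply: sigT_continuous => -[n x]; exact: h.
by rewrite (_ : f \o _ = unstable.sigT_fun g) //; apply/funext => -[[n x] t].
Qed.

(** [R] is locally compact, so taking the product with it commutes with
    quotients; this is phrased through the compact-open topology. *)
Lemma realization_prod_continuous (T : topologicalType) (F : realization R X * R -> T) :
  (forall n (x : X n),
    continuous (fun p : @std_simplex R n * R => F (rcell x p.1, p.2))) ->
  continuous F.
Proof.
Import ArrowAsCompactOpen.
move=> h; rewrite -[F]curryK.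
have cR : continuous (curry F).
  apply: realization_continuous => n x.
  exact: (continuous_curry_fun (h n x)).
apply: continuous_uncurry cR _; [exact: locally_compactR|exact: norm_hausdorff|].
apply: realization_ind => n x t.
exact: (continuous_curry (h n x)).2.
Qed.

End RealizationTopology.

Lemma rcell_continuous (R : realType) (X : sset) n (x : X n) :
  continuous (@rcell R X n x).
Proof.
move=> t; rewrite /rcell; apply: continuous_comp (@pi_continuous _ _ _).
exact: (@existT_continuous _
  (fun s : {n : nat & X n} => set_type (@std_simplex R (projT1 s))) (existT _ n x)).
Qed.

Section Lift.
Variables (R : realType) (X : sset) (S : Type).
Variable f : forall n, X n -> @std_simplex R n -> S.

Definition realization_lift (p : realization R X) : S :=
  let s := realization_repr p in f (projT2 (projT1 s)) (projT2 s).

(** Compatibility with one gluing step propagates along the generated equivalence relation, which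
    makes the chosen representative irrelevant. *)
Lemma realization_liftE :
  (forall m n (a : dmap m n) (x : X n) (t : @std_simplex R m),
    f (sact a x) t = f x (simplex_push a t)) ->
  forall n (x : X n) t, realization_lift (rcell x t) = f x t.
Proof.
move=> fact n x t.
rewrite -[f x t]/(f (projT2 (projT1 (cell x t))) (projT2 (cell x t))).
have /realization_piP := realization_reprK (rcell x t).
rewrite /realization_lift; move: (realization_repr _) => s.
by elim=> {x t s} [_ _ [m k a x t]|//|p q _ -> //|p q r _ -> _ -> //]; exact: fact.
Qed.

End Lift.

Lemma rcell_prod_continuous (R : realType) (X : sset) n (x : X n) :
  continuous (fun p : @std_simplex R n * R => (rcell x p.1, p.2)).
Proof.
move=> [t u]; apply: (@cvg_pair _ _ _ _ (nbhs (rcell x t)) (nbhs u)); last exact: cvg_snd.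
apply: (@cvg_comp _ _ _ fst (@rcell R X n x) _ (nbhs t)); first exact: cvg_fst.
exact: rcell_continuous.
Qed.

Lemma realization_map_rcell (R : realType) (X Y : sset) (f : shom X Y) n
  (x : X n) (t : @std_simplex R n) :
  realization_map f (rcell x t) = rcell (f n x) t.
Proof. exact: realization_mapE. Qed.

Lemma realization_map_continuous (R : realType) (X Y : sset) (f : shom X Y) :
  continuous (@realization_map R X Y f).
Proof.
apply: realization_continuous => n x.
under eq_fun do rewrite realization_map_rcell.
exact: rcell_continuous.
Qed.

Lemma homotopic_eq (R : realType) (S T : topologicalType) (f g : S -> T) :
  continuous f -> f =1 g -> homotopic R f g.
Proof.
move=> cf fg; exists (fun p => f p.1); split=> // p.
apply: continuous_subspaceT => q; apply: continuous_comp; last exact: cf.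
exact: cvg_fst.
Qed.

(** The degreewise inverses commute with the simplicial operators, so they realize to an inverse
    homeomorphism and both homotopies are constant. *)
Lemma bijective_shomotopy_equivalence (R : realType) (X Y : sset) (f : shom X Y) :
  (forall n, bijective (f n)) -> shomotopy_equivalence R f.
Proof.
move=> bijf.
have /all_sig[g fgK] n : {g : Y n -> X n | cancel (f n) g /\ cancel g (f n)}.
  by apply: cid; have [g] := bijf n; exists g.
have fK n : cancel (f n) (g n) by have [] := fgK n.
have gK n : cancel (g n) (f n) by have [] := fgK n.
have gact m n (t : dmap m n) (y : Y n) : g m (sact t y) = sact t (g n y).
  by rewrite -[y in LHS]gK -sfun_act fK.
pose g' := SHom gact.
have cf := @realization_map_continuous R _ _ f.
have cg := @realization_map_continuous R _ _ g'.
split=> //; exists (realization_map g'); split=> //; apply: homotopic_eq.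
- by move=> p; apply: continuous_comp; [exact: cf|exact: cg].
- by apply: realization_ind => n x t; rewrite /= !realization_map_rcell /= fK.
- by move=> p; apply: continuous_comp; [exact: cg|exact: cf].
- by apply: realization_ind => n x t; rewrite /= !realization_map_rcell /= gK.
Qed.

(** * The collapse of a subcomplex and maps out of the quotient *)

Section QuotientMaps.
Variables (X : sset) (A : subsset X).

Lemma squot_proj_act m n (t : dmap m n) (x : X n) :
  squot_proj A (sact t x) = sact (s := squot A) t (squot_proj A x).
Proof. by rewrite /= squot_act_proj. Qed.

Definition squot_hom : shom X (squot A) := @SHom X (squot A) _ squot_proj_act.

Lemma squot_proj_val n (u : set_type (~` A n)) : squot_proj A (val u) = Some u.
Proof. by rewrite /squot_proj valK. Qed.

Lemma squot_projS n (x : X n) (h : x \in ~` A n) : squot_proj A x = Some (SigSub h).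
Proof. by rewrite -squot_proj_val. Qed.

Lemma squot_proj_ind n (P : squot A n -> Prop) :
  P None -> (forall x, ~ A n x -> P (squot_proj A x)) -> forall y, P y.
Proof.
move=> p0 p1 [u|//]; rewrite -squot_proj_val; apply: p1.
by have := valP u; rewrite inE.
Qed.

Lemma squot_proj_inj n (x y : X n) : ~ A n x -> squot_proj A x = squot_proj A y -> x = y.
Proof.
move=> nx; have hx : x \in ~` A n by rewrite inE.
have [Ay|ny] := pselect (A n y); first by rewrite (squot_projN Ay) (squot_projS hx).
have hy : y \in ~` A n by rewrite inE.
by rewrite (squot_projS hx) (squot_projS hy) => -[].
Qed.

Lemma squot_projNE n (x : X n) : squot_proj A x = None -> A n x.
Proof.
move=> e; apply: contrapT => nAx.
have hx : x \in ~` A n by rewrite inE.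
by rewrite (squot_projS hx) in e.
Qed.

Section Lift.
Variables (Y : psset) (h : shom X Y).
Hypothesis hA : forall n x, A n x -> h n x = sbase Y n.

Definition squot_lift_fun n (y : squot A n) : Y n :=
  if y is Some u then h n (val u) else sbase Y n.

Lemma squot_lift_proj n (x : X n) : squot_lift_fun (squot_proj A x) = h n x.
Proof.
have [Ax|nAx] := pselect (A n x); first by rewrite squot_projN //= hA.
have hx : x \in ~` A n by rewrite inE.
by rewrite (squot_projS hx).
Qed.

Lemma squot_lift_act m n (t : dmap m n) (y : squot A n) :
  squot_lift_fun (sact t y) = sact t (squot_lift_fun y).
Proof.
elim/squot_proj_ind: y => [|x _]; first by rewrite /= sbase_act.
by rewrite -squot_proj_act !squot_lift_proj sfun_act.
Qed.

Definition squot_lift : shom (squot A) Y := SHom squot_lift_act.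

End Lift.

Lemma realization_map_squot_surj (R : realType) :
  (forall n, A n !=set0) -> forall q, exists p, @realization_map R _ _ squot_hom p = q.
Proof.
move=> A0; apply: realization_ind => n y t.
elim/squot_proj_ind: y => [|x _]; last first.
  by exists (rcell x t); rewrite realization_map_rcell.
by have [x Ax] := A0 n; exists (rcell x t); rewrite realization_map_rcell /= squot_projN.
Qed.

(** Every base simplex is a degeneracy of the base vertex, so both points are pushed to the single
    point of the 0-simplex. *)
Lemma rcell_squot_base (R : realType) n k (t : @std_simplex R n) (u : @std_simplex R k) :
  rcell (sbase (squot A) n) t = rcell (sbase (squot A) k) u.
Proof.
pose a j : dmap j 0 := @mkchain _ 'I_1 j (fun=> ord0) (fun _ _ _ => lexx _).
rewrite -(sbase_act (squot A) (a n)) -(sbase_act (squot A) (a k)) !rcell_glue; congr rcell.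
have sum1 (v : @std_simplex R 0) : val v 0 0 = 1.
  by have := valP v; rewrite inE => -[_]; rewrite big_ord1.
by apply/val_inj/rowP => j; rewrite !ord1 !sum1.
Qed.

Lemma realization_map_squot_base (R : realType) n k (x : X n) (y : X k)
    (t : @std_simplex R n) (u : @std_simplex R k) : A n x -> A k y ->
  realization_map squot_hom (rcell x t) = realization_map squot_hom (rcell y u).
Proof.
move=> Ax Ay; rewrite !realization_map_rcell /= !squot_projN //.
exact: rcell_squot_base.
Qed.

(** This lets a homotopy that is constant on the subcomplex descend to the quotient. *)
Lemma squot_factor (R : realType) (T : topologicalType)
  (F : realization R X * R -> T) (c : T) :
  continuous F ->
  (forall n (x : X n) t u, A n x -> F (rcell x t, u) = c) ->
  exists G : realization R (squot A) * R -> T,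
    continuous G /\
    forall p u, G (realization_map squot_hom p, u) = F (p, u).
Proof.
move=> cF Fc.
pose gc n (y : squot A n) t u :=
  if y is Some v then F (rcell (val v) t, u) else c.
have gcE n (x : X n) t u : gc n (squot_proj A x) t u = F (rcell x t, u).
  have [Ax|nAx] := pselect (A n x); first by rewrite squot_projN //= Fc.
  have hx : x \in ~` A n by rewrite inE.
  by rewrite (squot_projS hx).
have gcact m n (a : dmap m n) (y : squot A n) t u :
    gc m (sact a y) t u = gc n y (simplex_push a t) u.
  elim/squot_proj_ind: y => [//|x _].
  by rewrite -squot_proj_act !gcE rcell_glue.
(* Only the simplex coordinate is glued, so the lift takes its values in functions of the
   parameter. *)
pose G (qu : realization R (squot A) * R) := realization_lift gc qu.1 qu.2.
have GE n (y : squot A n) t u : G (rcell y t, u) = gc n y t u.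
  rewrite /G /= realization_liftE // => m k a {}y {}t.
  by apply/funext => v; exact: gcact.
exists G; split.
  apply: realization_prod_continuous => n y.
  under eq_fun do rewrite GE.
  case: y => [v|]; last by move=> p; exact: cvg_cst.
  by move=> p; exact: (continuous_comp (@rcell_prod_continuous R X n (val v) p) (cF _)).
move=> p u; elim/realization_ind: p => n x t.
by rewrite realization_map_rcell GE gcE.
Qed.

End QuotientMaps.

(** * Maps out of coproducts, and nerves of monotone maps *)

Section ScoprodLift.
Variables (I : choiceType) (X : I -> sset) (Y : sset) (h : forall i, shom (X i) Y).

Definition scoprod_lift_fun n (x : scoprod X n) : Y n := h _ _ (projT2 x).

Lemma scoprod_lift_act m n (t : dmap m n) (x : scoprod X n) :
  scoprod_lift_fun (sact t x) = sact t (scoprod_lift_fun x).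
Proof. by case: x => i x; rewrite /scoprod_lift_fun /= sfun_act. Qed.

Definition scoprod_lift : shom (scoprod X) Y := SHom scoprod_lift_act.

End ScoprodLift.

Section NerveMap.
Variables (d1 d2 : Order.disp_t) (P : porderType d1) (Q : porderType d2).
Variables (f : P -> Q) (fle : {homo f : x y / (x <= y)%O}).

Lemma chain_map_subproof n (c : chain P n) : monotoneb [ffun i => f (val c i)].
Proof.
by apply/monotonebP => i j ij; rewrite !ffunE; apply: fle; exact: (monotonebP _ (valP c)).
Qed.

Definition chain_map n (c : chain P n) : chain Q n :=
  exist (fun f : {ffun _ -> _} => monotoneb f) _ (chain_map_subproof c).

Lemma chain_mapE n (c : chain P n) i : val (chain_map c) i = f (val c i).
Proof. by rewrite /= ffunE. Qed.

Lemma chain_map_act m n (t : dmap m n) (c : nerve P n) :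
  chain_map (sact t c) = sact (s := nerve Q) t (chain_map c).
Proof. by apply/val_inj/ffunP => i; rewrite /= !ffunE. Qed.

Definition nerve_map : shom (nerve P) (nerve Q) :=
  @SHom (nerve P) (nerve Q) _ chain_map_act.

End NerveMap.

Definition shom_comp (X Y Z : sset) (f : shom Y Z) (g : shom X Y) : shom X Z.
Proof.
exists (fun n x => f n (g n x)) => m n t x.
by rewrite !sfun_act.
Defined.

(** * The isomorphism from the wedge of suspensions to N(V)/N(Y) *)

Section WedgeIso.
Variables (d : Order.disp_t) (V : porderType d) (H : set V).
Hypothesis Hmax : H `<=` [set W | is_maximal W].

Let NY := nerve_sub (~` H).
Let cone (W : V) := with_top (set_type (strictly_below W)).
Let susp (W : H) := suspension (strictly_below (val W)).

(** The added top is sent to W, which identifies the cone with the elements of V below or equal to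
    W. *)
Definition cone_incl (W : V) (x : cone W) : V :=
  if x is Some v then val v else W.

Lemma cone_incl_le W : {homo @cone_incl W : x y / (x <= y)%O}.
Proof.
move=> [u|] [v|] //= _.
by have := valP u; rewrite inE => /ltW.
Qed.

(** An element strictly below W is not maximal, hence not in H. *)
Lemma cone_incl_H (W : V) (HW : H W) (x : cone W) : H (cone_incl x) -> x = None.
Proof.
case: x => // u Hu; have := valP u; rewrite inE => uW.
have ltuW : (val u < W)%O by [].
have e : W = val u := Hmax Hu (ltW ltuW).
by move: ltuW; rewrite [X in (_ < X)%O]e ltxx.
Qed.

Lemma cone_incl_inj (W : V) : injective (@cone_incl W).
Proof.
have ltN (u : set_type (strictly_below W)) : val u <> W.
  by have := valP u; rewrite inE /strictly_below /= => + e; rewrite e ltxx.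
move=> [u|] [v|] //=; first by move/val_inj ->.
- by move/ltN.
- by move/esym/ltN.
Qed.

Definition cone_hom (W : H) :=
  shom_comp (squot_hom NY) (nerve_map (@cone_incl_le (val W))).

Lemma cone_hom_base (W : H) n (x : nerve (cone (val W)) n) :
  nerve_sub (range (Some : set_type (strictly_below (val W)) -> with_top _)) n x ->
  cone_hom W n x = sbase (squot NY) n.
Proof.
move=> h; apply: squot_projN => i; rewrite /= ffunE => Hi.
have [u _ e] := h i.
have HW : H (val W) by have := valP W; rewrite inE.
by have := cone_incl_H HW Hi; rewrite -e.
Qed.

Definition susp_hom (W : H) : shom (susp W) (squot NY) :=
  squot_lift (cone_hom_base (W := W)).

Lemma wedge_hom_base n x :
  base_points susp n x -> scoprod_lift susp_hom n x = sbase (squot NY) n.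
Proof. by case: x => W x e; rewrite /= /scoprod_lift_fun (e : x = None). Qed.

Definition wedge_hom : shom (swedge susp) (squot NY) := squot_lift wedge_hom_base.

Definition wedge_cone n (W : H) (c : nerve (cone (val W)) n) : swedge susp n :=
  squot_proj _ (existT _ W (squot_proj _ c) : scoprod susp n).

(** A normal form that hides the two nested quotients, by base points and by the bottom of each
    cone. *)
Variant wedge_spec n : swedge susp n -> Prop :=
| WedgeBase : wedge_spec None
| WedgeCone (W : H) (c : nerve (cone (val W)) n) i of val c i = None :
    wedge_spec (wedge_cone c).

Lemma wedgeP n (y : swedge susp n) : wedge_spec y.
Proof.
elim/squot_proj_ind: y => [|[W y]]; first exact: WedgeBase.
elim/squot_proj_ind: y => [[]//|c nc _].
have [i ci] : exists i, val c i = None.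
  apply: contra_notP nc => /forallNP nc i.
  by case e : (val c i) => [u|]; [exists u|case: (nc i)].
exact: WedgeCone ci.
Qed.

Lemma wedge_hom_cone n (W : H) (c : nerve (cone (val W)) n) :
  wedge_hom n (wedge_cone c) =
  squot_proj NY (chain_map (@cone_incl_le (val W)) c).
Proof.
apply: (etrans (squot_lift_proj wedge_hom_base _)).
exact: (squot_lift_proj (cone_hom_base (W := W))).
Qed.

(** A chain that reaches the top of its cone is not collapsed, and the only element of H in its
    image is W, so the image recovers both the summand and the chain. *)
Lemma wedge_hom_inj n : injective (wedge_hom n).
Proof.
have HH (W : H) : H (val W) by have := valP W; rewrite inE.
have nNY (W : H) (c : nerve (cone (val W)) n) i :
    val c i = None -> ~ NY n (chain_map (@cone_incl_le (val W)) c).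
  by move=> ci /(_ i); rewrite chain_mapE ci; apply; exact: HH.
move=> y y'; case: (wedgeP y) => [|W c i ci]; case: (wedgeP y') => [|W' c' i' ci'] //.
- by rewrite wedge_hom_cone => /esym/squot_projNE /nNY -/(_ _ ci').
- by rewrite wedge_hom_cone => /squot_projNE /nNY -/(_ _ ci).
rewrite !wedge_hom_cone => /squot_proj_inj -/(_ (nNY _ _ _ ci)) e.
have {e} ej j : cone_incl (val c j) = cone_incl (val c' j).
  by have := congr1 (fun x : chain V n => val x j) e; rewrite !chain_mapE.
(* At an index where [c] is at the top, the common image lies in H, so [c'] is at the top there as
   well. *)
have eW : W = W'.
  apply: val_inj; move: (ej i); rewrite ci /= => e.
  have c'i : val c' i = None.
    by apply: (cone_incl_H (HH W')); rewrite -e; exact: HH.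
  by rewrite e c'i.
move: {i' ci'} c' ej; rewrite -{}eW => c' ej.
suff -> : c = c' by [].
by apply/val_inj/ffunP => j; exact/cone_incl_inj/ej.
Qed.

(** Here [insub] sends W itself, the only value not strictly below W, to the added top [None]. *)
Lemma cone_chain_subproof (W : V) n (x : chain V n) :
  (forall i, (val x i <= W)%O) ->
  monotoneb [ffun i => insub (val x i) : cone W].
Proof.
move=> xW; apply/monotonebP => i j ij; rewrite !ffunE.
have xij : (val x i <= val x j)%O by exact: (monotonebP _ (valP x)).
case: (insubP (set_type (strictly_below W)) (val x j)) => [v xj ev|_]; last first.
  by case: insubP.
have xiW : val x i \in strictly_below W.
  by move: xj; rewrite !inE; exact: le_lt_trans.
rewrite (insubT (fun z => z \in strictly_below W) xiW).
by change (val x i <= val v)%O; rewrite ev.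
Qed.

(** A chain outside N(Y) meets H, and by maximality the element of H that it meets bounds the whole
    chain, which therefore lifts to the cone over that element. *)
Lemma wedge_hom_surj n (z : squot NY n) : exists y, wedge_hom n y = z.
Proof.
elim/squot_proj_ind: z => [|x nx]; first by exists None.
have [i Hi] : exists i, H (val x i).
  by apply: contra_notP nx => /forallNP nx i; exact: nx.
have xW j : (val x j <= val x i)%O.
  have [ij|/ltnW ji] := leqP i j; last exact: (monotonebP _ (valP x)).
  have /(Hmax Hi) -> // : (val x i <= val x j)%O by exact: (monotonebP _ (valP x)).
pose W : H := SigSub (mem_set Hi).
pose c : nerve (cone (val W)) n :=
  exist (fun f : {ffun _ -> _} => monotoneb f) _ (cone_chain_subproof xW).
exists (wedge_cone c).
rewrite wedge_hom_cone; congr squot_proj; apply/val_inj/ffunP => j.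
rewrite chain_mapE /= ffunE; case: insubP => [u _ eu|]; first exact: eu.
rewrite notin_setE => nlt; have := xW j.
by rewrite le_eqVlt => /orP[/eqP ->|/nlt].
Qed.

Lemma wedge_hom_bij n : bijective (wedge_hom n).
Proof.
have [g gK] := choice (@wedge_hom_surj n).
by exists g => // y; apply: wedge_hom_inj; rewrite gK.
Qed.

End WedgeIso.

(** * Points of |N(V)| as weights on the elements of V *)

Section Mass.
Variables (R : realType) (d : Order.disp_t) (V : porderType d).
Implicit Types (P : pred V) (p q : realization R (nerve V)).

Lemma simplex_push_sum m n (a : dmap m n) (t : @std_simplex R m) (Q : pred 'I_n.+1) :
  \sum_(j | Q j) val (simplex_push a t) 0 j = \sum_(i | Q (val a i)) val t 0 i.
Proof.
under eq_bigr do rewrite /= mxE.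
rewrite [in RHS](partition_big (fun i => val a i) Q) //=.
by apply: eq_bigr => j Qj; apply: eq_bigl => i; case: eqP => [->|]; rewrite ?Qj ?andbF.
Qed.

Lemma simplex_ge0 n (t : @std_simplex R n) i : 0 <= val t 0 i.
Proof. by have := valP t; rewrite inE => -[]. Qed.

Lemma simplex_sum1 n (t : @std_simplex R n) : \sum_i val t 0 i = 1.
Proof. by have := valP t; rewrite inE => -[]. Qed.

(** [mass P p] is the total weight that the point p of |NV|, seen as a convex
    combination of elements of V, gives to the elements satisfying P. *)
Definition mass P : realization R (nerve V) -> R :=
  realization_lift (fun n (x : nerve V n) (t : @std_simplex R n) =>
    \sum_(i | P (val x i)) val t 0 i).

Lemma mass_rcell P n (x : nerve V n) (t : @std_simplex R n) :
  mass P (rcell x t) = \sum_(i | P (val x i)) val t 0 i.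
Proof.
apply: realization_liftE => {}n m a {}x {}t.
by rewrite simplex_push_sum; apply: eq_bigl => i; rewrite /= ffunE.
Qed.

Lemma mass_ge0 P p : 0 <= mass P p.
Proof.
elim/realization_ind: p => n x t.
by rewrite mass_rcell sumr_ge0// => i _; exact: simplex_ge0.
Qed.

Lemma mass_neq0 n (x : nerve V n) (t : @std_simplex R n) v :
  mass (pred1 v) (rcell x t) != 0 -> exists2 i, val t 0 i != 0 & val x i = v.
Proof.
rewrite mass_rcell psumr_neq0 => [/hasP[i _ /andP[/eqP xi ti]]|i _]; last first.
  exact: simplex_ge0.
by exists i => //; rewrite gt_eqF.
Qed.

Lemma mass_gt0 P n (x : nerve V n) (t : @std_simplex R n) i :
  P (val x i) -> val t 0 i != 0 -> mass P (rcell x t) != 0.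
Proof.
move=> Pi ti; rewrite mass_rcell psumr_neq0 => [|j _]; last exact: simplex_ge0.
by apply/hasP; exists i; rewrite ?mem_index_enum //= Pi lt_def ti simplex_ge0.
Qed.

Lemma chain_le d' (Q : porderType d') n (x : chain Q n) (i j : 'I_n.+1) :
  (i <= j)%N -> (val x i <= val x j)%O.
Proof. exact: (monotonebP _ (valP x)). Qed.

(** Vertices of zero weight are replaced by neighbours of nonzero weight. *)
Lemma rcell_support n (x : nerve V n) (t : @std_simplex R n) :
  exists2 y : nerve V n,
    forall i, exists2 j, val t 0 j != 0 & val y i = val x j & rcell x t = rcell y t.
Proof.
have [j0 tj0] : exists j, val t 0 j != 0.
  apply/existsP; rewrite -[X in is_true X]negbK negb_exists; apply/negP => /forallP h.
  have := simplex_sum1 t; rewrite big1 => [/eqP|i _]; first by rewrite eq_sym oner_eq0.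
  by apply/eqP/negPn.
pose jm := [arg max_(j > j0 | val t 0 j != 0) (j : nat)].
have [tjm jmM] : val t 0 jm != 0 /\ forall j, val t 0 j != 0 -> (j <= jm)%N.
  by rewrite /jm; case: arg_maxnP.
(* Index i moves to the first index of nonzero weight at or after it. The minimum with [jm] sends
   the indices beyond the last nonzero weight back to that one. *)
pose Q (i j : 'I_n.+1) := (val t 0 j != 0) && (minn i jm <= j)%N.
pose a i := [arg min_(j < jm | Q i j) (j : nat)].
have aP i : Q i (a i) /\ forall j, Q i j -> (a i <= j)%N.
  by rewrite /a; case: arg_minnP => //; rewrite /Q tjm geq_minr.
have ale (i j : 'I_n.+1) : (i <= j)%N -> (a i <= a j)%O.
  move=> ij; rewrite leEord; apply: (aP i).2; rewrite /Q.
  have /andP[-> h] := (aP j).1; apply: leq_trans h.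
  by rewrite leq_min geq_minr andbT (leq_trans (geq_minl _ _) ij).
have aid i : val t 0 i != 0 -> a i = i.
  move=> ti; apply/val_inj/eqP; rewrite /= eqn_leq (aP i).2; last first.
    by rewrite /Q ti geq_minl.
  by have /andP[_] := (aP i).1; rewrite (minn_idPl (jmM _ ti)).
pose A : dmap n n := mkchain ale.
exists (sact (s := nerve V) A x).
  by move=> i; exists (a i); [have /andP[] := (aP i).1|rewrite /= !ffunE].
rewrite rcell_glue; congr rcell; apply/val_inj/rowP => j.
rewrite /= mxE; have [tj|tj] := eqVneq (val t 0 j) 0.
  rewrite [LHS]tj big1 // => i /eqP; rewrite ffunE => e.
  by have /andP[] := (aP i).1; rewrite e tj eqxx.
rewrite (bigD1 j) /=; last by rewrite ffunE aid.
rewrite big1 ?addr0 // => i /andP[/eqP + ij]; rewrite ffunE => e.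
by apply: contraNeq ij => ti; rewrite -e aid.
Qed.

(** Repeated vertices are merged into the first occurrence. *)
Lemma rcell_collapse n m (x : nerve V n) (t : @std_simplex R n) (y : nerve V m) :
  (forall i, exists j, val x i = val y j) ->
  exists2 u : @std_simplex R m, rcell x t = rcell y u &
    forall j, val u 0 j = if [forall k : 'I_m.+1, (k < j)%N ==> (val y k != val y j)]
                          then mass (pred1 (val y j)) (rcell x t) else 0.
Proof.
move=> xy.
have /choice[b bP] (i : 'I_n.+1) : exists j : 'I_m.+1, val x i = val y j /\
    forall k : 'I_m.+1, val x i = val y k -> (j <= k)%N.
  have [j /eqP xj] := xy i.
  by case: (@arg_minnP _ j (fun k => val x i == val y k)
    (fun k : 'I_m.+1 => (k : nat)) xj) => k /eqP xk kP; exists k; split=> // l /eqP; exact: kP.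
have ble (i j : 'I_n.+1) : (i <= j)%N -> (b i <= b j)%O.
  move=> ij; rewrite leEord leqNgt; apply/negP => ji.
  have /chain_le := ltnW ji; move/(_ _ _ y); rewrite -(bP i).1 -(bP j).1 => le1.
  have e : val x i = val x j by apply/le_anti; rewrite le1 chain_le.
  by have := (bP i).2 (b j); rewrite e -(bP j).1 => /(_ erefl); rewrite leqNgt ji.
pose B : dmap n m := mkchain ble.
have xB : x = sact (s := nerve V) B y.
  by apply/val_inj/ffunP => i; rewrite /= !ffunE -(bP i).1.
exists (simplex_push B t); first by rewrite {1}xB rcell_glue.
move=> j; rewrite /= mxE mass_rcell; case: ifP => [/forallP h|/negP h].
  apply: eq_bigl => i /=; rewrite ffunE; apply/eqP/eqP => [<-|e]; first exact: (bP i).1.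
  apply/val_inj/eqP; rewrite /= eqn_leq (bP i).2 //= leqNgt; apply/negP => ij.
  by have := h (b i); rewrite ij /= -(bP i).1 e eqxx.
rewrite big1 // => i /eqP; rewrite ffunE => e; case: h; apply/forallP => k.
apply/implyP => kj; apply/eqP => yk; have := (bP i).2 k.
by rewrite (bP i).1 e yk => /(_ erefl); rewrite leqNgt kj.
Qed.

(** Once zero weights are removed, every vertex of one chain has nonzero mass and so occurs in the
    other. Both points are then moved to that other chain, where the masses dictate the coordinates.
    Points of |N(V)| can thus be compared, and maps into it defined, through masses alone. *)
Lemma mass_inj p q : (forall v, mass (pred1 v) p = mass (pred1 v) q) -> p = q.
Proof.
elim/realization_ind: p => n x0 t; elim/realization_ind: q => m y0 u.
have [x xS ex] := rcell_support x0 t; have [y yS ey] := rcell_support y0 u.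
move=> h.
have xy i : exists j, val x i = val y j.
  have [j tj xj] := xS i.
  have : mass (pred1 (val x i)) (rcell x0 t) != 0.
    by apply: (mass_gt0 (i := j)); rewrite /= ?xj.
  by rewrite h ey => /mass_neq0[k _ <-]; exists k.
have [u1 e1 u1E] := rcell_collapse t xy.
have [u2 e2 u2E] := rcell_collapse u (fun j => ex_intro _ j (erefl (val y j))).
rewrite ex ey e1 e2; congr rcell; apply/val_inj/rowP => j.
by rewrite u1E u2E -ex -ey h.
Qed.

(** * Points and continuous maps given by weights on a finite family of elements *)

Section Family.
Variables (K : finType) (q : K -> V).

Let leq_q (k l : K) := (q k <= q l)%O.

Section Seq.
Variables (k0 : K) (s : seq K).
Hypothesis sq : sorted leq_q (k0 :: s).
Hypothesis us : uniq (k0 :: s).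

Lemma family_chain_subproof (i j : 'I_(size s).+1) :
  (i <= j)%N -> (q (nth k0 (k0 :: s) i) <= q (nth k0 (k0 :: s) j))%O.
Proof.
move=> ij; apply: (@sorted_leq_nth _ leq_q) => //; rewrite ?inE //.
- by move=> ? ? ?; exact: le_trans.
- by move=> ?; exact: lexx.
Qed.

Definition family_chain : nerve V (size s) := mkchain family_chain_subproof.

Lemma family_sum (a : K -> R) (Q : pred K) :
  (forall k, k \notin k0 :: s -> a k = 0) ->
  \sum_(j < (size s).+1 | Q (nth k0 (k0 :: s) j)) a (nth k0 (k0 :: s) j) =
  \sum_(k | Q k) a k.
Proof.
move=> a0; rewrite -(big_mkord (fun j => Q (nth k0 (k0 :: s) j))
  (fun j => a (nth k0 (k0 :: s) j))).
rewrite -(big_nth k0 Q a (r := k0 :: s)) big_mkcond big_uniq //= [RHS]big_mkcond /=.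
rewrite [LHS]big_mkcond /=; apply: eq_bigr => k _.
by case: ifPn => // /a0 ->; rewrite if_same.
Qed.

Lemma family_simplex_subproof (a : K -> R) :
  (forall k, 0 <= a k) -> \sum_k a k = 1 -> (forall k, k \notin k0 :: s -> a k = 0) ->
  \row_(j < (size s).+1) a (nth k0 (k0 :: s) j) \in @std_simplex R (size s).
Proof.
move=> a_ge0 a1 a0; rewrite inE; split=> [j|]; first by rewrite mxE.
by under eq_bigr do rewrite mxE; rewrite (@family_sum a xpredT).
Qed.

Lemma mass_family (a : K -> R) a_ge0 a1 (a0 : forall k, k \notin k0 :: s -> a k = 0) P :
  mass P (rcell family_chain (SigSub (@family_simplex_subproof a a_ge0 a1 a0))) =
  \sum_(k | P (q k)) a k.
Proof.
rewrite mass_rcell -(@family_sum a (fun k => P (q k))) //=.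
by apply: eq_big => [j|j _]; rewrite ?mxE // ffunE.
Qed.

End Seq.

Definition comparable_on (J : {set K}) :=
  [forall k in J, forall l in J, leq_q k l || leq_q l k].

Lemma comparable_sort (J : {set K}) : comparable_on J ->
  sorted leq_q (sort leq_q (enum J)).
Proof.
move=> /forall_inP h.
apply: (@sort_sorted_in _ (mem J)); last by apply/allP => k; rewrite mem_enum.
by move=> k l kJ lJ; exact: (forall_inP (h k kJ)).
Qed.

(** The indices of nonzero weight are sorted into a chain; there is at least one because the weights
    sum to 1. *)
Lemma family_point (a : K -> R) :
  (forall k, 0 <= a k) -> \sum_k a k = 1 ->
  (forall k l, a k != 0 -> a l != 0 -> leq_q k l || leq_q l k) ->
  exists p, forall P, mass P p = \sum_(k | P (q k)) a k.
Proof.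
move=> a_ge0 a1 cmp; pose J := [set k | a k != 0]%SET.
have cJ : comparable_on J.
  apply/forall_inP => k; rewrite inE => ak; apply/forall_inP => l.
  by rewrite inE; exact: cmp.
have := comparable_sort cJ.
have memJ k : (k \in sort leq_q (enum J)) = (a k != 0) by rewrite mem_sort mem_enum inE.
have : uniq (sort leq_q (enum J)) by rewrite sort_uniq enum_uniq.
case: (sort _ _) memJ => [|k0 s] memJ us ss.
  move/eqP: a1; rewrite big1 ?(eq_sym 0) ?oner_eq0 // => k _; apply/eqP.
  by rewrite -[_ == _]negbK -memJ.
have a0 k : k \notin k0 :: s -> a k = 0 by rewrite memJ negbK => /eqP.
exists (rcell (family_chain ss) (SigSub (family_simplex_subproof us a_ge0 a1 a0))) => P.
exact: mass_family.
Qed.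

(** On the closed set where the weights vanish outside a totally ordered
    subfamily, the map lands in a single simplex; these closed sets form a
    finite cover. *)
Lemma family_continuous (S : topologicalType) (a : S -> K -> R)
    (f : S -> realization R (nerve V)) :
  (forall k, continuous (a^~ k)) -> (forall u k, 0 <= a u k) ->
  (forall u, \sum_k a u k = 1) ->
  (forall u k l, a u k != 0 -> a u l != 0 -> leq_q k l || leq_q l k) ->
  (forall u v, mass (pred1 v) (f u) = \sum_(k | q k == v) a u k) ->
  continuous f.
Proof.
move=> ac a_ge0 a1 cmp fE; apply/continuous_closedP => B cB.
pose C (J : {set K}) := [set u | forall k, k \notin J -> a u k = 0] `&` f @^-1` B.
have -> : f @^-1` B = \bigcup_(J in [set J | comparable_on J]) C J.
  apply/seteqP; split=> [u fu|u [J _ []//]].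
  exists [set k | a u k != 0]%SET.
    apply/forall_inP => k; rewrite inE => ak; apply/forall_inP => l.
    by rewrite inE; exact: cmp.
  by split=> // k; rewrite inE negbK => /eqP.
apply: closed_bigcup => [|J cJ]; first exact: finite_finset.
have memJ k : (k \in sort leq_q (enum J)) = (k \in J) by rewrite mem_sort mem_enum.
have := comparable_sort cJ.
have : uniq (sort leq_q (enum J)) by rewrite sort_uniq enum_uniq.
case: (sort _ _) memJ => [|k0 s] memJ us ss.
  (* For empty [J] all weights would vanish, against their sum being 1. *)
  rewrite (_ : C J = set0); first exact: closed0.
  apply/seteqP; split=> // u [aJ _]; have /eqP := a1 u.
  by rewrite big1 ?(eq_sym 0) ?oner_eq0 // => k _; apply: aJ; rewrite -memJ.
have cZ : closed (rcell (family_chain ss) @^-1` B).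
  by have /continuous_closedP := @rcell_continuous R _ _ (family_chain ss); exact.
(* The row [r u] of weights lies in the simplex only when the weights vanish outside [J]. The closed
   set is therefore extended to all rows, so that its preimage under [r] makes sense on the whole of
   [S]. *)
have [D cD DE] : exists2 D : set 'rV[R]_(size s).+1, closed D &
    set_val @^-1` D = rcell (family_chain ss) @^-1` B.
  have := cZ; rewrite -openC => -[D oD DE]; exists (~` D); first by rewrite closedC.
  by rewrite -[RHS]setCK -DE preimage_setC.
pose r u : 'rV[R]_(size s).+1 := \row_j a u (nth k0 (k0 :: s) j).
have rc : continuous r.
  move=> u A [P nP sPA].
  have h j : \forall v \near u, P 0 j (a v (nth k0 (k0 :: s) j)).
    by apply: ac; have := nP 0 j; rewrite mxE.
  have hh : nbhs u (fun v => forall j, P 0 j (a v (nth k0 (k0 :: s) j))).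
    exact: filter_forall.
  suff : nbhs u (r @^-1` A) by [].
  by apply: filterS hh => v Pv; apply: sPA => i j; rewrite ord1 mxE; exact: Pv.
have rD u : (forall k, k \notin J -> a u k = 0) -> D (r u) <-> B (f u).
  move=> aJ; have a0 k : k \notin k0 :: s -> a u k = 0 by rewrite memJ; exact: aJ.
  pose t : @std_simplex R (size s) :=
    SigSub (family_simplex_subproof us (a_ge0 u) (a1 u) a0).
  rewrite -[D (r u)]/((set_val @^-1` D) t) DE /=.
  suff -> : rcell (family_chain ss) t = f u by [].
  by apply: mass_inj => v; rewrite mass_family fE.
have -> : C J =
    (\bigcap_(k in [set k | k \notin J]) (a^~ k) @^-1` [set x | x = 0]) `&` r @^-1` D.
  by apply/seteqP; split=> u [aJ /(rD u aJ)].
apply: closedI; last by move/continuous_closedP: rc; exact.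
by apply: closed_bigI => k _; have /continuous_closedP := ac k; apply; exact: closed_eq.
Qed.

End Family.
End Mass.

(** * Pointwise operations on continuous real functions *)

Section ContinuousReal.
Variables (R : realType) (S : topologicalType).
Implicit Types f g : S -> R.

Lemma continuous_minr f g :
  continuous f -> continuous g -> continuous (fun x => Num.min (f x) (g x)).
Proof. by move=> cf cg x; exact: (continuous_min (cf x) (cg x)). Qed.

Lemma continuous_maxr f g :
  continuous f -> continuous g -> continuous (fun x => Num.max (f x) (g x)).
Proof. by move=> cf cg x; exact: (continuous_max (cf x) (cg x)). Qed.

Lemma continuous_addr f g :
  continuous f -> continuous g -> continuous (fun x => f x + g x).
Proof. by move=> cf cg x; exact: (cvgD (cf x) (cg x)). Qed.

Lemma continuous_subr f g :
  continuous f -> continuous g -> continuous (fun x => f x - g x).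
Proof. by move=> cf cg x; exact: (cvgB (cf x) (cg x)). Qed.

Lemma continuous_mulr f g :
  continuous f -> continuous g -> continuous (fun x => f x * g x).
Proof. by move=> cf cg x; exact: (cvgM (cf x) (cg x)). Qed.

Lemma continuous_divr f g : (forall x, g x != 0) ->
  continuous f -> continuous g -> continuous (fun x => f x / g x).
Proof. by move=> g0 cf cg x; exact: (cvgM (cf x) (cvgV (g0 x) (cg x))). Qed.

Lemma continuous_sumr (I : finType) (P : pred I) (F : I -> S -> R) :
  (forall i, continuous (F i)) -> continuous (fun x => \sum_(i | P i) F i x).
Proof. by move=> cF x; apply: cvg_big => [|i _]; [exact: add_continuous|exact: cF]. Qed.

End ContinuousReal.

(** * Simplex points as subdivisions of [0, 1], and their reparametrization *)

Section Slices.
Variable R : realType.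

Definition partial_sum n (t : 'rV[R]_n.+1) (i : nat) : R :=
  \sum_(k < n.+1 | (k < i)%N) t 0 k.

(** A point of the simplex cuts [0, 1] into consecutive intervals of lengths
    t_0, ..., t_n; [slice g t i] is the length of the image of the i-th one
    under the nondecreasing function g. *)
Definition slice (g : R -> R) n (t : 'rV[R]_n.+1) (i : 'I_n.+1) : R :=
  g (partial_sum t i.+1) - g (partial_sum t i).

Lemma partial_sum0 n (t : 'rV[R]_n.+1) : partial_sum t 0 = 0.
Proof. by rewrite /partial_sum big_pred0. Qed.

Lemma partial_sumS n (t : 'rV[R]_n.+1) (i : 'I_n.+1) :
  partial_sum t i.+1 = partial_sum t i + t 0 i.
Proof.
rewrite /partial_sum (bigD1 i) //= addrC; congr (_ + _).
by apply: eq_bigl => k; rewrite ltnS -val_eqE /= ltn_neqAle andbC.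
Qed.

Lemma slice_initial g n (t : 'rV[R]_n.+1) c :
  \sum_(i < n.+1 | (i < c)%N) slice g t i = g (partial_sum t c) - g 0.
Proof.
elim: c => [|c IH]; first by rewrite partial_sum0 subrr big_pred0.
have [cn|nc] := ltnP c n.+1; last first.
  have ic (i : 'I_n.+1) : (i < c.+1)%N = (i < c)%N.
    by rewrite ltnS (leq_trans (ltn_ord i) nc) ltnW // (leq_trans (ltn_ord i)).
  by rewrite /partial_sum !(eq_bigl _ _ ic) IH.
rewrite (bigD1 (Ordinal cn)) //= (eq_bigl (fun i : 'I_n.+1 => (i < c)%N)).
  by rewrite IH /slice /= addrA subrK.
by move=> k; rewrite ltnS -val_eqE /= ltn_neqAle andbC.
Qed.

(** A downward closed set of indices is an initial segment, over which the slices telescope. *)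
Lemma slice_lower g n (t : 'rV[R]_n.+1) (D : pred 'I_n.+1) :
  (forall i j : 'I_n.+1, (i <= j)%N -> D j -> D i) ->
  \sum_(i | D i) slice g t i = g (\sum_(i | D i) t 0 i) - g 0.
Proof.
move=> Dlow; pose c := \max_(i | D i) i.+1.
have Dc i : D i = (i < c)%N.
  apply/idP/idP => [Di|]; first exact: (@leq_bigmax_cond _ D (fun i : 'I_n.+1 => i.+1)).
  apply: contraLR => nDi; rewrite -leqNgt; apply/bigmax_leqP => j Dj.
  by rewrite ltnNge; apply: contra nDi => ij; exact: Dlow ij Dj.
by rewrite !(eq_bigl _ _ Dc) slice_initial.
Qed.

Lemma slice_sum g n (t : @std_simplex R n) :
  \sum_i slice g (val t) i = g 1 - g 0.
Proof. by rewrite (@slice_lower _ _ _ xpredT) // simplex_sum1. Qed.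

(** Since [a] is monotone, pushing forward merges consecutive intervals. Each slice is a difference
    of two sums over initial segments, and those are preserved. *)
Lemma slice_push_sum g m n (a : dmap m n) (t : @std_simplex R m) (Q : pred 'I_n.+1) :
  \sum_(j | Q j) slice g (val (simplex_push a t)) j =
  \sum_(i | Q (val a i)) slice g (val t) i.
Proof.
have pE c : partial_sum (val (simplex_push a t)) c = \sum_(i | (val a i < c)%N) val t 0 i.
  exact: (simplex_push_sum a t (fun j : 'I_n.+1 => (j < c)%N)).
have sE c : g (partial_sum (val (simplex_push a t)) c) - g 0 =
    \sum_(i | (val a i < c)%N) slice g (val t) i.
  rewrite pE slice_lower // => i j ij; apply: leq_ltn_trans.
  by have := chain_le a ij; rewrite leEord.
rewrite [in RHS](partition_big (fun i => val a i) Q) //=.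
apply: eq_bigr => j Qj.
have -> : slice g (val (simplex_push a t)) j =
    \sum_(i | (val a i < j.+1)%N) slice g (val t) i -
    \sum_(i | (val a i < j)%N) slice g (val t) i.
  by rewrite -!sE /slice; lra.
rewrite (bigID (fun i => val a i == j)) /= addrC -addrA.
rewrite (eq_bigl (fun i => (val a i < j)%N)); last first.
  by move=> i; rewrite ltnS -val_eqE /= [RHS]ltn_neqAle andbC.
rewrite addrCA subrr addr0; apply: eq_bigl => i.
by have [->|] := eqVneq (val a i) j; rewrite ?leqnn ?Qj ?andbF.
Qed.

Lemma slice0 g n (t : 'rV[R]_n.+1) i : t 0 i = 0 -> slice g t i = 0.
Proof. by move=> ti; rewrite /slice partial_sumS ti addr0 subrr. Qed.

Lemma partial_sum_le n (t : @std_simplex R n) i j :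
  (i <= j)%N -> partial_sum (val t) i <= partial_sum (val t) j.
Proof.
move=> ij; rewrite /partial_sum [leRHS](bigID (fun k : 'I_n.+1 => (k < i)%N)) /=.
rewrite [X in _ <= X + _](eq_bigl (fun k : 'I_n.+1 => (k < i)%N)).
  by rewrite lerDl sumr_ge0 // => k _; exact: simplex_ge0.
by move=> k; case: (ltnP k i) => ki; rewrite ?andbF ?andbT // (leq_trans ki).
Qed.

Lemma partial_sum_ge0 n (t : @std_simplex R n) i : 0 <= partial_sum (val t) i.
Proof. by rewrite sumr_ge0 // => k _; exact: simplex_ge0. Qed.

Lemma partial_sum_le1 n (t : @std_simplex R n) i : partial_sum (val t) i <= 1.
Proof.
rewrite -(simplex_sum1 t) [leRHS](bigID (fun k : 'I_n.+1 => (k < i)%N)) /=.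
by rewrite lerDl sumr_ge0 // => k _; exact: simplex_ge0.
Qed.

Lemma slice_ge0 g n (t : @std_simplex R n) i :
  {homo g : u v / u <= v} -> 0 <= slice g (val t) i.
Proof. by move=> gle; rewrite subr_ge0; apply/gle/partial_sum_le. Qed.

End Slices.

(** * The deformation of |N(V)| and the collapse of |N(Y)| *)

Section Deformation.
Variables (R : realType) (d : Order.disp_t) (V : porderType d) (H : set V).
Hypothesis Hmax : H `<=` [set W | is_maximal W].
Variables (L : V) (m : V -> V).
Hypothesis HL : ~ H L.
Hypothesis mN : forall v, ~ H v -> ~ H (m v).
Hypothesis le_m : forall v, ~ H v -> (v <= m v)%O.
Hypothesis le_Lm : forall v, ~ H v -> (L <= m v)%O.
Hypothesis m_le : forall v w, ~ H v -> ~ H w -> (v <= w)%O -> (m v <= m w)%O.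

Let HB : pred V := fun v => `[< H v >].

(** At time u, a point giving mass s to H has its step function rescaled by
    [1 / scale s u].  If [bottom_len s u = 0], the values on [keep s u, 1] are then
    moved by m; if [keep s u = 0], all values are moved by m, except on
    [0, bottom_len s u], where they become L. *)
Definition clamp (u : R) : R := Num.min 1 (Num.max 0 u).
Definition scale (s u : R) : R := Num.max (1 - clamp u / 2) (1 - s).
(** For u in [0, 1], the scale has come down to [1 - s] exactly when u reaches [2 * s], and the
    phase starts at that moment. It reaches at most 2: [keep] shrinks while it goes from 0 to 1,
    [bottom_len] grows while it goes from 1 to 2. *)
Definition phase (s u : R) : R := 2 * Num.max 0 (clamp u - 2 * s).
Definition keep (s u : R) : R := Num.max 0 (1 - phase s u).
Definition bottom_len (s u : R) : R := Num.max 0 (phase s u - 1).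

(** Slices under [keep_map] measure what lies in [0, [keep]] after rescaling, those under [move_map]
    what lies in [[bottom_len + keep], 1]. *)
Definition rescale s u (r : R) : R := Num.min 1 (r / scale s u).
Definition keep_map s u (r : R) : R := Num.min (rescale s u r) (keep s u).
Definition move_map s u (r : R) : R := Num.max (rescale s u r) (bottom_len s u + keep s u).

Definition vertex_index n : finType := ('I_n.+1 + 'I_n.+1 + unit)%type.

Definition vertex n (x : chain V n) (k : vertex_index n) : V :=
  match k with inl (inl i) => val x i | inl (inr i) => m (val x i) | inr _ => L end.

Definition weight s u n (t : 'rV[R]_n.+1) (k : vertex_index n) : R :=
  match k with
  | inl (inl i) => slice (keep_map s u) t i
  | inl (inr i) => slice (move_map s u) t i
  | inr _ => bottom_len s u
  end.

Lemma sum_index n (P : pred (vertex_index n)) (F : vertex_index n -> R) :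
  \sum_(k | P k) F k =
  \sum_(i | P (inl (inl i))) F (inl (inl i)) + \sum_(i | P (inl (inr i))) F (inl (inr i)) +
  (if P (inr tt) then F (inr tt) else 0).
Proof.
rewrite !big_sumType; congr (_ + _); rewrite big_mkcond /= (bigD1 tt) //=.
by rewrite big1 ?addr0 // => -[] /eqP.
Qed.

Lemma clamp_bounds u : 0 <= clamp u <= 1.
Proof. by rewrite /clamp; case: (leP 0 u) => ?; case: (leP 1 _) => ?; lra. Qed.

Lemma scale_gt0 s u : 0 < scale s u.
Proof.
by have := clamp_bounds u; rewrite /scale; case: (leP (1 - clamp u / 2)) => ?; lra.
Qed.

Lemma scale_le1 s u : 0 <= s -> scale s u <= 1.
Proof.
by have := clamp_bounds u; rewrite /scale; case: (leP (1 - clamp u / 2)) => ?; lra.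
Qed.

Lemma keep_dropP s u : 0 <= s ->
  [/\ 0 <= keep s u, 0 <= bottom_len s u, bottom_len s u + keep s u <= 1 &
      bottom_len s u != 0 -> keep s u = 0].
Proof.
move=> s0; have := clamp_bounds u; rewrite /keep /bottom_len.
have : 0 <= phase s u <= 2.
  have := clamp_bounds u; rewrite /phase; case: (leP 0 (_ - _)) => ?; lra.
move: (phase s u) (clamp u) => b c b02 c01.
case: (leP 0 (1 - b)) => h1; case: (leP 0 (b - 1)) => h2; split; rewrite ?eqxx //; lra.
Qed.

(** A positive phase forces [clamp u] above [2 * s]: vertices are moved only after the part in H has
    been pushed out. *)
Lemma keep_lt1 s u : bottom_len s u + keep s u < 1 -> scale s u = 1 - s.
Proof.
have := clamp_bounds u; rewrite /keep /bottom_len /phase /scale; move: (clamp u) => c c01.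
case: (leP 0 (c - 2 * s)) => h1; case: (leP 0 (1 - _)) => h2;
  case: (leP 0 (_ - 1)) => h3; case: (leP (1 - c / 2)) => h4; lra.
Qed.

Lemma ler_rescale s u : {homo rescale s u : r r' / r <= r'}.
Proof.
move=> r r' rr'; rewrite /rescale le_min ge_min lexx /= ge_min.
by rewrite [X in _ || X]ler_pM2r ?invr_gt0 ?scale_gt0 // rr' orbT.
Qed.

Lemma rescale0 s u : rescale s u 0 = 0.
Proof. by rewrite /rescale mul0r min_r. Qed.

Lemma rescale1 s u : 0 <= s -> rescale s u 1 = 1.
Proof.
by move=> s0; rewrite /rescale min_l // div1r invf_ge1 ?scale_gt0 // scale_le1.
Qed.

Lemma ler_keep_map s u : {homo keep_map s u : r r' / r <= r'}.
Proof.
by move=> r r' /(ler_rescale s u) h; apply: le_min2.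
Qed.

Lemma ler_move_map s u : {homo move_map s u : r r' / r <= r'}.
Proof.
by move=> r r' /(ler_rescale s u) h; apply: le_max2.
Qed.

Lemma slice_keep_neq0 s u n (t : @std_simplex R n) i :
  slice (keep_map s u) (val t) i != 0 -> rescale s u (partial_sum (val t) i) < keep s u.
Proof.
move=> w0; rewrite ltNge; apply: contra w0 => h; apply/eqP.
rewrite /slice /keep_map min_r; last first.
  by apply: le_trans h _; apply/ler_rescale/partial_sum_le.
by rewrite min_r ?subrr.
Qed.

Lemma slice_move_neq0 s u n (t : @std_simplex R n) i :
  slice (move_map s u) (val t) i != 0 ->
  bottom_len s u + keep s u < rescale s u (partial_sum (val t) i.+1) /\
  rescale s u (partial_sum (val t) i) < 1.
Proof.
have le_i : rescale s u (partial_sum (val t) i) <= rescale s u (partial_sum (val t) i.+1).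
  by apply/ler_rescale/partial_sum_le.
have le1 j : rescale s u (partial_sum (val t) j) <= 1 by rewrite /rescale ge_min lexx.
move=> w0; split; rewrite ltNge; apply: contra w0 => h; apply/eqP;
  rewrite /slice /move_map.
  by rewrite !max_r ?subrr // (le_trans le_i).
suff -> : rescale s u (partial_sum (val t) i.+1) = rescale s u (partial_sum (val t) i).
  by rewrite subrr.
by apply/le_anti; rewrite le_i andbT (le_trans (le1 _) h).
Qed.

(** The vertices in [H] come last in a chain. *)
Lemma partial_sum_H n (x : chain V n) (t : @std_simplex R n) j :
  H (val x j) -> 1 - \sum_(i | HB (val x i)) val t 0 i <= partial_sum (val t) j.
Proof.
move=> Hj; rewrite -(simplex_sum1 t) (bigID (fun i => HB (val x i))) /= addrC addrK.
rewrite /partial_sum [leRHS](bigID (fun i => HB (val x i))) /= addrC.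
rewrite (eq_bigl (fun i : 'I_n.+1 => (i < j)%N && ~~ HB (val x i))).
  by rewrite lerDl sumr_ge0 // => i _; exact: simplex_ge0.
move=> i; case: ltnP => //= ji; apply/negbTE; rewrite negbK; apply/asboolP.
by rewrite (Hmax Hj (chain_le x ji)).
Qed.

Section Cell.
Variables (n : nat) (x : nerve V n) (t : @std_simplex R n) (u : R).
Let s := \sum_(i | HB (val x i)) val t 0 i.

Let s_ge0 : 0 <= s.
Proof. by rewrite sumr_ge0 // => i _; exact: simplex_ge0. Qed.

Lemma weight_ge0 k : 0 <= weight s u (val t) k.
Proof.
case: k => [[i|i]|[]] /=; last by have [] := keep_dropP u s_ge0.
- exact/slice_ge0/ler_keep_map.
- exact/slice_ge0/ler_move_map.
Qed.

Lemma weight_sum1 : \sum_k weight s u (val t) k = 1.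
Proof.
rewrite sum_index /= !slice_sum.
rewrite /keep_map /move_map rescale0 rescale1 //.
have [k0 d0 dk1 _] := keep_dropP u s_ge0.
rewrite (min_r (_ : keep s u <= 1)) ?(min_l k0) ?(max_l dk1) ?(max_r (_ : 0 <= _)); lra.
Qed.

(** Intervals with value in H start at or after [1 - s]. When something is moved the scale equals
    [1 - s], so after rescaling they start at 1 and have no length left. Hence [m] is only ever
    applied outside H. *)
Lemma weight_move_H i : weight s u (val t) (inl (inr i)) != 0 -> ~ H (val x i).
Proof.
move=> /slice_move_neq0[h1 h2] /partial_sum_H -/(_ t); rewrite -/s => h.
have /keep_lt1 sc : bottom_len s u + keep s u < 1.
  by apply: lt_le_trans h1 _; rewrite /rescale ge_min lexx.
move: h2; rewrite /rescale sc; apply/negP; rewrite -leNgt le_min lexx /=.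
by rewrite ler_pdivlMr ?mul1r // -sc scale_gt0.
Qed.

(** The vertices carrying weight form a chain, either of kept values followed by moved ones, or of L
    followed by moved values. *)
Lemma weight_comparable k l : weight s u (val t) k != 0 -> weight s u (val t) l != 0 ->
  (vertex x k <= vertex x l)%O || (vertex x l <= vertex x k)%O.
Proof.
have cmp (i j : 'I_n.+1) : (val x i <= val x j)%O || (val x j <= val x i)%O.
  by apply/orP; have [ij|/ltnW ij] := leqP i j; [left|right]; exact: chain_le.
(* A kept interval starts before [keep] and a moved one ends after it, so i is at most j and x_i <=
   x_j <= m(x_j). *)
have keep_move i j : weight s u (val t) (inl (inl i)) != 0 ->
    weight s u (val t) (inl (inr j)) != 0 -> (val x i <= m (val x j))%O.
  move=> wi wj; have Hj := weight_move_H wj.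
  apply: le_trans (le_m Hj); apply: chain_le; rewrite leqNgt; apply/negP => ji.
  have := ler_rescale s u (partial_sum_le t ji).
  have := slice_keep_neq0 wi; have [] := slice_move_neq0 wj.
  have [] := keep_dropP u s_ge0; lra.
have keep_drop i : weight s u (val t) (inl (inl i)) != 0 -> bottom_len s u != 0 -> False.
  move=> wi d0; have [_ _ _ /(_ d0) k0] := keep_dropP u s_ge0.
  have := slice_keep_neq0 wi; rewrite k0; apply/negP; rewrite -leNgt -(rescale0 s u).
  by apply/ler_rescale/partial_sum_ge0.
have lower i : weight s u (val t) (inl (inr i)) != 0 -> (L <= m (val x i))%O.
  by move=> /weight_move_H; exact: le_Lm.
case: k l => [[i|i]|[]] [[j|j]|[]] wk wl /=.
- exact: cmp.
- by rewrite keep_move.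
- by have := keep_drop _ wk wl.
- by rewrite orbC keep_move.
- have /orP[h|h] := cmp i j; apply/orP; [left|right];
    by apply: m_le => //; exact: weight_move_H.
- by rewrite lower ?orbT.
- by have := keep_drop _ wl wk.
- by rewrite lower.
- by rewrite lexx.
Qed.

End Cell.

(** The weights respect the gluing of cells, which makes the deformation well defined. *)
Lemma weight_push s u k n (a : dmap k n) (x : nerve V n) (t : @std_simplex R k)
    (P : pred V) :
  \sum_(i | P (vertex x i)) weight s u (val (simplex_push a t)) i =
  \sum_(i | P (vertex (sact a x) i)) weight s u (val t) i.
Proof.
rewrite !sum_index /=; congr (_ + _ + _).
- apply: etrans (slice_push_sum _ a t (fun i => P (val x i))) _.
  by apply: eq_bigl => i; rewrite /= ffunE.
- apply: etrans (slice_push_sum _ a t (fun i => P (m (val x i)))) _.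
  by apply: eq_bigl => i; rewrite /= ffunE.
Qed.

Lemma deform_point n (x : nerve V n) (t : @std_simplex R n) u :
  {p : realization R (nerve V) | forall P,
    mass P p = \sum_(k | P (vertex x k)) weight (mass HB (rcell x t)) u (val t) k}.
Proof.
apply: cid; rewrite mass_rcell.
exact: (family_point (weight_ge0 x t u) (weight_sum1 x t u) (@weight_comparable n x t u)).
Qed.

(** The target point is chosen on each cell by its masses, which determine it uniquely. *)
Definition deform (pu : realization R (nerve V) * R) : realization R (nerve V) :=
  realization_lift (fun n (x : nerve V n) (t : @std_simplex R n) u =>
    sval (deform_point x t u)) pu.1 pu.2.

Lemma mass_deform n (x : nerve V n) (t : @std_simplex R n) u P :
  mass P (deform (rcell x t, u)) =
  \sum_(k | P (vertex x k)) weight (mass HB (rcell x t)) u (val t) k.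
Proof.
rewrite /deform /= realization_liftE; first exact: (svalP (deform_point x t u)).
move=> j k a {}x {}t; apply/funext => v; apply: mass_inj => w.
rewrite (svalP (deform_point _ _ _)) (svalP (deform_point _ _ _)).
by rewrite rcell_glue weight_push.
Qed.

(** At time 0 the scale and [keep] are both 1, so every interval is kept whole and nothing is
    moved. *)
Lemma deform0 p : deform (p, 0) = p.
Proof.
elim/realization_ind: p => n x t; apply: mass_inj => v.
have s0 := mass_ge0 HB (rcell x t).
rewrite mass_deform [RHS]mass_rcell sum_index /=; set s := mass HB _ in s0 *.
have c0 : clamp 0 = 0 by rewrite /clamp maxxx min_r.
have ph0 : phase s 0 = 0 by rewrite /phase c0 max_l ?mulr0 //; lra.
have k1 : keep s 0 = 1 by rewrite /keep ph0 subr0 max_r.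
have d0 : bottom_len s 0 = 0 by rewrite /bottom_len ph0 max_l //; lra.
have sc1 : scale s 0 = 1 by rewrite /scale c0 mul0r subr0 max_l //; lra.
have rE i : rescale s 0 (partial_sum (val t) i) = partial_sum (val t) i.
  by rewrite /rescale sc1 divr1 min_r // partial_sum_le1.
rewrite d0 if_same addr0 [X in _ + X]big1 ?addr0 => [|i _].
  apply: eq_bigr => i _; rewrite /slice /keep_map !rE k1 !min_l ?partial_sum_le1 //.
  by rewrite partial_sumS addrC addKr.
by rewrite /slice /move_map !rE d0 k1 add0r !max_r ?partial_sum_le1 ?subrr.
Qed.

(** Without mass in H the phase reaches 2 at time 1, so [bottom_len] is 1 and all the weight sits on
    L. *)
Lemma deform1 p n (x : nerve V n) (t : @std_simplex R n) :
  mass HB p = 0 -> (forall i, val x i = L) -> deform (p, 1) = rcell x t.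
Proof.
elim/realization_ind: p => k y v s0 xL; apply: mass_inj => w.
rewrite mass_deform sum_index /= s0.
have c1 : clamp 1 = 1 :> R by rewrite /clamp max_r ?minxx.
have ph2 : phase 0 1 = 2 :> R by rewrite /phase c1 mulr0 subr0 max_r ?mulr1.
have k0 : keep 0 1 = 0 :> R by rewrite /keep ph2 max_l //; lra.
have d1 : bottom_len 0 1 = 1 :> R by rewrite /bottom_len ph2 max_r //; lra.
have r01 i : 0 <= rescale 0 1 (partial_sum (val v) i) <= 1.
  rewrite -{1}(rescale0 0 1) ler_rescale ?partial_sum_ge0 //=.
  by rewrite /rescale ge_min lexx.
rewrite !big1 => [|i _|i _].
- rewrite !add0r mass_rcell d1.
  under eq_bigl do rewrite /= xL; case: eqP => _; last by rewrite big_pred0.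
  by rewrite simplex_sum1.
- have /andP[_ h1] := r01 i; have /andP[_ h2] := r01 i.+1.
  rewrite /slice /move_map k0 d1 addr0.
  by rewrite !max_r ?subrr.
- have /andP[h1 _] := r01 i; have /andP[h2 _] := r01 i.+1.
  rewrite /slice /keep_map k0.
  by rewrite !min_r ?subrr.
Qed.

(** The deformation preserves |N(Y)|: L is outside H, m(v) is in H only if v is, and an interval of
    zero length has zero slices. *)
Lemma deform_H p u : mass HB p = 0 -> mass HB (deform (p, u)) = 0.
Proof.
elim/realization_ind: p => n x t s0.
have tH i : HB (val x i) -> val t 0 i = 0.
  by move=> Hi; apply/eqP/negPn/negP => ti; have /eqP := mass_gt0 Hi ti.
have HBL : HB L = false by exact: asboolF.
rewrite mass_deform sum_index /= HBL addr0 !big1 ?addr0 // => i Hi;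
  apply: slice0; apply: tH => //.
apply/asboolP; apply: contrapT => nH; exact: (mN nH (asboolW Hi)).
Qed.

Section ParameterContinuity.
Variables (S : topologicalType) (s u r : S -> R).
Hypotheses (s_cts : continuous s) (u_cts : continuous u) (r_cts : continuous r).

Let cst_cts (c : R) : continuous (fun _ : S => c).
Proof. by move=> x; exact: cvg_cst. Qed.

Lemma continuous_clamp : continuous (fun x => clamp (u x)).
Proof. by apply: continuous_minr => //; exact: continuous_maxr. Qed.

Lemma continuous_scale : continuous (fun x => scale (s x) (u x)).
Proof.
apply: continuous_maxr; apply: continuous_subr => //.
by apply: continuous_mulr => //; exact: continuous_clamp.
Qed.

Lemma continuous_phase : continuous (fun x => phase (s x) (u x)).
Proof.
apply: continuous_mulr => //; apply: continuous_maxr => //.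
by apply: continuous_subr; [exact: continuous_clamp|exact: continuous_mulr].
Qed.

Lemma continuous_keep : continuous (fun x => keep (s x) (u x)).
Proof.
by apply: continuous_maxr => //; apply: continuous_subr => //; exact: continuous_phase.
Qed.

Lemma continuous_drop : continuous (fun x => bottom_len (s x) (u x)).
Proof.
by apply: continuous_maxr => //; apply: continuous_subr => //; exact: continuous_phase.
Qed.

Lemma continuous_rescale : continuous (fun x => rescale (s x) (u x) (r x)).
Proof.
apply: continuous_minr => //; apply: continuous_divr => //; last exact: continuous_scale.
by move=> x; rewrite gt_eqF // scale_gt0.
Qed.

Lemma continuous_keep_map : continuous (fun x => keep_map (s x) (u x) (r x)).
Proof. by apply: continuous_minr; [exact: continuous_rescale|exact: continuous_keep]. Qed.

Lemma continuous_move_map : continuous (fun x => move_map (s x) (u x) (r x)).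
Proof.
apply: continuous_maxr; first exact: continuous_rescale.
by apply: continuous_addr; [exact: continuous_drop|exact: continuous_keep].
Qed.

End ParameterContinuity.

(** On each cell the weights are continuous in the point and the time, and they sit on a finite
    family of vertices. *)
Lemma deform_continuous : continuous deform.
Proof.
apply: realization_prod_continuous => n x.
pose a (p : @std_simplex R n * R) k := weight (mass HB (rcell x p.1)) p.2 (val p.1) k.
have coord i : continuous (fun p : @std_simplex R n * R => val p.1 0 i).
  move=> p.
  apply: (@cvg_comp _ _ _ fst (fun t : @std_simplex R n => val t 0 i) _ (nbhs p.1)).
    exact: cvg_fst.
  apply: (@continuous_comp _ _ _ (fun t : @std_simplex R n => val t)
    (fun t : 'rV_n.+1 => t 0 i)).
    exact: initial_continuous.
  exact: coord_continuous.
have sum_cts (P : pred 'I_n.+1) :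
    continuous (fun p : @std_simplex R n * R => \sum_(i | P i) val p.1 0 i).
  exact: continuous_sumr.
have s_cts : continuous (fun p : @std_simplex R n * R => mass HB (rcell x p.1)).
  by under eq_fun do rewrite mass_rcell; exact: sum_cts.
have u_cts : continuous (fun p : @std_simplex R n * R => p.2) by move=> p; exact: cvg_snd.
apply: (@family_continuous R d V (vertex_index n) (vertex x) _ a).
- case=> [[i|i]|[]]; last exact: continuous_drop.
  + by apply: continuous_subr; apply: continuous_keep_map => //; exact: sum_cts.
  + by apply: continuous_subr; apply: continuous_move_map => //; exact: sum_cts.
- by move=> p k; rewrite /a mass_rcell; exact: weight_ge0.
- by move=> p; rewrite /a mass_rcell; exact: weight_sum1.
- by move=> p k l; rewrite /a mass_rcell; exact: weight_comparable.
- by move=> p v; rewrite mass_deform.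
Qed.

Let NY := nerve_sub (~` H).

Lemma mass_nerve_sub n (x : nerve V n) (t : @std_simplex R n) :
  NY n x -> mass HB (rcell x t) = 0.
Proof.
move=> Yx; rewrite mass_rcell big_pred0 // => i.
by apply: asboolF; exact: Yx.
Qed.

(** A point without mass in H is supported on a chain in Y, so it collapses to the base point. *)
Lemma collapse_mass0 (p q : realization R (nerve V)) : mass HB p = 0 -> mass HB q = 0 ->
  realization_map (squot_hom NY) p = realization_map (squot_hom NY) q.
Proof.
have repr_NY (r : realization R (nerve V)) : mass HB r = 0 ->
    exists n (x : nerve V n) (t : @std_simplex R n), r = rcell x t /\ NY n x.
  elim/realization_ind: r => n x t r0.
  have [y yx ->] := rcell_support x t; exists n, y, t; split=> // i Hi.
  have [j tj e] := yx i; have Hj : HB (val x j) by rewrite -e; exact/asboolP.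
  by have /eqP := mass_gt0 Hj tj.
move=> /repr_NY[n [x [t [-> Yx]]]] /repr_NY[k [y [v [-> Yy]]]].
exact: realization_map_squot_base.
Qed.

Lemma collapse_equivalence : shomotopy_equivalence R (squot_hom NY).
Proof.
pose g := @realization_map R _ _ (squot_hom NY).
have cg : continuous g by exact: realization_map_continuous.
have YL n : NY n (mkchain (fun (_ _ : 'I_n.+1) _ => lexx L)).
  by move=> i; rewrite /= ffunE.
have g_surj := @realization_map_squot_surj _ NY R (fun n => ex_intro _ _ (YL n)).
have t0P : const_mx 1 \in @std_simplex R 0.
  by rewrite inE; split=> [i|]; rewrite ?big_ord1 mxE.
pose pL : realization R (nerve V) :=
  rcell (mkchain (fun (_ _ : 'I_1) _ => lexx L) : nerve V 0) (SigSub t0P).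
have d1 p : mass HB p = 0 -> deform (p, 1) = pL.
  by move=> p0; apply: deform1 => // i; rewrite /= ffunE.
have mpL : mass HB pL = 0 by exact: mass_nerve_sub (YL 0).
have cdef (h : R -> R) : continuous h ->
    continuous (fun q : realization R (nerve V) * R => deform (q.1, h q.2)).
  move=> ch [p u].
  apply: (@continuous_comp _ _ _
    (fun q : realization R (nerve V) * R => (q.1, h q.2)) deform);
    last exact: deform_continuous.
  apply: (@cvg_pair _ _ _ _ (nbhs p) (nbhs (h u))); first exact: cvg_fst.
  by apply: (@cvg_comp _ _ _ snd h _ (nbhs u)); [exact: cvg_snd|exact: ch].
(* Time is reversed because the required homotopies end at the identity, whereas the deformation
   starts there. *)
have rev_cts : continuous (fun u : R => 1 - u).
  by apply: continuous_subr => u; [exact: cvg_cst|exact: cvg_id].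
(* The homotopy inverse is the final map of the deformation, factored through the quotient; its time
   parameter is a dummy. *)
have [k' [ck k'g]] : exists G : realization R (squot NY) * R -> realization R (nerve V),
    continuous G /\ forall p u, G (g p, u) = deform (p, 1).
  apply: (@squot_factor _ NY R _ (fun q => deform (q.1, 1)) pL).
    by apply: (cdef (fun=> 1)) => u; exact: cvg_cst.
  by move=> n x t u Yx; rewrite /= d1 //; exact: mass_nerve_sub.
have [G [cG Gg]] : exists G : realization R (squot NY) * R -> realization R (squot NY),
    continuous G /\ forall p u, G (g p, u) = g (deform (p, 1 - u)).
  apply: (@squot_factor _ NY R _ (fun q => g (deform (q.1, 1 - q.2))) (g pL)).
    move=> q; exact: (continuous_comp (cdef _ rev_cts q) (cg _)).
  (* |N(Y)| is preserved at all times, so its collapsed image stays at the base point. *)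
  move=> n x t u Yx; apply: (@collapse_mass0 (deform (rcell x t, 1 - u)) pL _ mpL).
  apply: deform_H.
  exact: mass_nerve_sub.
split=> //; exists (fun q => k' (q, 0)); split.
- have c0 : continuous (fun q : realization R (squot NY) => (q, 0 : R)).
    move=> q; exact: (cvg_pair (@cvg_id _ (nbhs q))
      (@cst_continuous (realization R (squot NY)) R 0 q)).
  by move=> q; exact: (continuous_comp (c0 q) (ck _)).
- exists (fun q => deform (q.1, 1 - q.2)); split=> [|p|p].
  + by apply: continuous_subspaceT; exact: (cdef _ rev_cts).
  + by rewrite /= subr0 k'g.
  + by rewrite /= subrr deform0.
- exists G; split=> [|q|q]; first exact: continuous_subspaceT.
  + by have [p <-] := g_surj q; rewrite /= Gg subr0 k'g.
  + by have [p <-] := g_surj q; rewrite /= Gg subrr deform0.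
Qed.

End Deformation.

Theorem corollary3p1p3 (R : realType) (d : Order.disp_t) (V : porderType d)
  (H : set V) (Hmax : H `<=` [set W | is_maximal W])
  (hL : exists L : V,
      H = [set W | is_maximal W /\ ~ (L <= W)%O] /\
      (forall W : V, (~` H) W -> supremums [set L; W] !=set0)) :
  exists (f : shom (swedge (fun W : H => suspension (strictly_below (val W))))
                   (squot (nerve_sub (~` H))))
         (g : shom (nerve V) (squot (nerve_sub (~` H)))),
    shomotopy_equivalence R f /\ shomotopy_equivalence R g.
Proof.
exists (wedge_hom Hmax), (squot_hom _); split.
  by apply: bijective_shomotopy_equivalence => n; exact: wedge_hom_bij.
have [L [HE sup]] := hL.
(* By (i) nothing above L lies in H, so L and the suprema with L all lie in Y. *)
have aboveL W : (L <= W)%O -> ~ H W by rewrite HE => LW [].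
(* The value on H is arbitrary, and is set to L. *)
have /choice[m mP] W : exists z, ~ H W -> supremums [set L; W] z.
  have [HW|/sup[z zP]] := pselect (H W); last by exists z.
  by exists L.
have ubL W : ~ H W -> (L <= m W)%O by move=> /mP[ub _]; apply: ub; left.
have ubW W : ~ H W -> (W <= m W)%O by move=> /mP[ub _]; apply: ub; right.
apply: (@collapse_equivalence R d V H Hmax L m) => //.
- exact: aboveL.
- by move=> W /ubL/aboveL.
(* Monotonicity of [m]: the supremum for [W'] is an upper bound of L and [W]. *)
- move=> W W' HW HW' WW'; have [_ lub] := mP _ HW; apply: lub => z [->|->].
    exact: ubL.
  exact: le_trans WW' (ubW _ HW').
Qed.
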